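(* For any graph $G$, $$\gamma_{\rm sp}(G)\ge \gamma_s(G).$$
   Context: All graphs are finite, simple and undirected. For a vertex $v$ of a graph $G$, $N(v)$ denotes the set of vertices adjacent to $v$. For $D\subseteq V(G)$ write $\overline{D}=V(G)\setminus D$. A set $D\subseteq V(G)$ is dominating if every vertex of $\overline{D}$ has a neighbour in $D$. A set $D\subseteq V(G)$ is a super dominating set of $G$ if for every $u\in\overline{D}$ there exists $v\in D$ such that $N(v)\cap\overline{D}=\{u\}$; the super domination number $\gamma_{\rm sp}(G)$ is the minimum cardinality of a super dominating set of $G$. A set $S\subseteq V(G)$ is a secure dominating set of $G$ if it is dominating and for every $v\in\overline{S}$ there exists $u\in N(v)\cap S$ such that $(S\setminus\{u\})\cup\{v\}$ is dominating; the secure domination number $\gamma_s(G)$ is the minimum cardinality of a secure dominating set of $G$. *)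

(* Defs.v *)
From mathcomp Require Import all_boot.

Set Implicit Arguments.
Unset Strict Implicit.
Unset Printing Implicit Defensive.

(* A finite simple graph is a symmetric irreflexive relation [e] on a finType;
   these two properties are assumed where needed, not in the definitions. *)
Section Domination.

Variables (V : finType) (e : rel V).

Implicit Types D S : {set V}.

Definition nbhd (v : V) : {set V} := [set w | e v w].

Definition dominating D : bool :=
  [forall u in ~: D, nbhd u :&: D != set0].

Definition super_dominating D : bool :=
  [forall u in ~: D, exists v in D, nbhd v :&: ~: D == [set u]].

Definition secure_dominating S : bool :=
  dominating S &&
  [forall v in ~: S, exists u in nbhd v :&: S, dominating (v |: (S :\ u))].

Lemma super_dominatingT : super_dominating [set: V].
Proof. by apply/forall_inP => u; rewrite !inE. Qed.

Lemma secure_dominatingT : secure_dominating [set: V].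
Proof. by apply/andP; split; apply/forall_inP => u; rewrite !inE. Qed.

(* [arg min_(D < D0 | P D) F D] needs a witness D0 of P: by the two lemmas
   above, the whole vertex set always is one, so these are true minima. *)
Definition super_domination_number : nat :=
  #|[arg min_(D < [set: V] | super_dominating D) #|D|]|.

Definition secure_domination_number : nat :=
  #|[arg min_(S < [set: V] | secure_dominating S) #|S|]|.

End Domination.

(* Main.v *)
(* Every super dominating set D is secure dominating. Choose for each w outside D
   some f(w) in D whose only neighbour outside D is w; f is injective, and f(w)
   dominates w. If an outside vertex v replaces f(v), then v dominates f(v), and
   every other outside vertex w keeps its neighbour f(w) <> f(v). *)
Require Import Defs.
From mathcomp Require Import all_boot.

(** As a boolean equation, the condition on [v] rewrites both ways: it yields the edge to [u] and
    excludes edges to all other vertices outside [D]. *)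
Lemma super_dominatingP (V : finType) (e : rel V) (D : {set V}) :
  reflect (forall u, u \notin D ->
             exists2 v, v \in D & forall w, w \notin D -> e v w = (w == u))
          (super_dominating e D).
Proof.
apply: (iffP forall_inP) => D_super u uD.
  have [|v vD /eqP/setP Nv] := exists_inP (D_super u _); first by rewrite inE.
  by exists v => // w wD; move: (Nv w); rewrite !inE wD andbT.
rewrite inE in uD; have [v vD Nv] := D_super u uD.
apply/exists_inP; exists v => //; apply/eqP/setP => w; rewrite !inE.
have [wD | wD] := boolP (w \in D); last by rewrite Nv // andbT.
by rewrite andbF; apply/esym/eqP => wu; rewrite wu (negPf uD) in wD.
Qed.

Lemma dominatingP (V : finType) (e : rel V) (D : {set V}) :
  reflect (forall u, u \notin D -> exists2 v, v \in D & e u v)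
          (dominating e D).
Proof.
apply: (iffP forall_inP) => D_dom u uD.
  have /D_dom/set0Pn[v] : u \in ~: D by rewrite inE.
  by rewrite !inE => /andP[euv vD]; exists v.
rewrite inE in uD; have [v vD euv] := D_dom u uD.
by apply/set0Pn; exists v; rewrite !inE euv.
Qed.

Lemma super_dominating_secure (V : finType) (e : rel V) (D : {set V}) :
  symmetric e -> super_dominating e D -> secure_dominating e D.
Proof.
move=> e_sym /super_dominatingP D_super; apply/andP; split.
  apply/dominatingP => u uD; have [v vD Nv] := D_super u uD.
  by exists v; rewrite // e_sym Nv.
apply/forall_inP => v; rewrite inE => vD; have [u uD Nu] := D_super v vD.
have euv : e u v by rewrite Nu.
apply/exists_inP; exists u; first by rewrite !inE e_sym euv.
apply/dominatingP => w; rewrite !inE negb_or negb_and negbK => /andP[wv].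
(* Outside the swapped set lie the removed [u] and the vertices other than [v] outside [D]. *)
have [-> _ | wu /= wD] := eqVneq w u; first by exists v; rewrite ?setU11.
have [x xD Nx] := D_super w wD; exists x; last by rewrite e_sym Nx.
(* If [x] were [u], then [w] would be a neighbour of [u] outside [D], forcing [w = v] by [Nu]. *)
rewrite !inE xD andbT; apply/orP; right; apply/eqP => xu.
by move: (Nx w wD); rewrite xu Nu // (negPf wv) eqxx.
Qed.

Theorem theorem8 (V : finType) (e : rel V)
    (e_sym : symmetric e) (e_irr : irreflexive e) :
  super_domination_number e >= secure_domination_number e.
Proof.
rewrite /super_domination_number /secure_domination_number.
case: arg_minnP => [|S _ S_min]; first exact: secure_dominatingT.
case: arg_minnP => [|D D_super _]; first exact: super_dominatingT.
(* [D] competes in the minimum that [S] attains. *)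
exact: S_min (super_dominating_secure _ _ _ e_sym D_super).
Qed.
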